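(* Let $B_0\supseteq B_1\supseteq B_2\supseteq\cdots$ be a scale of Banach spaces, let $\epsilon>0$, let $N\ge 1$ be an integer, $\Delta T=1/N$, $T_n=n\Delta T$ for $n=0,\dots,N$ (so $T_0=0$), and let $p\ge 1$. Let $\varphi_t$ and $\overline{\varphi}_t$ ($0\le t\le 1$) be, respectively, the evolution operator of the full equation and the asymptotic approximation operator described in the context, and let $\widetilde{\varphi}_{\Delta T}$ be the numerical approximation of $\overline{\varphi}_{\Delta T}$ that results from solving the averaged (slow) equation with an order $p$ time-stepping method, as described in the context. Set $$\mathcal{E}_{\varphi,\overline{\varphi}}(\mathbf{v})=\varphi_{\Delta T}(\mathbf{v})-\overline{\varphi}_{\Delta T}(\mathbf{v}),\qquad \mathcal{E}_{\overline{\varphi},\widetilde{\varphi}}(\mathbf{v})=\overline{\varphi}_{\Delta T}(\mathbf{v})-\widetilde{\varphi}_{\Delta T}(\mathbf{v}).$$ Assume there are constants $C_j$, $j=0,1,2,\dots$, such that for every $j\ge 0$ the following hold: 1. (Uniform boundedness) for $0\le t\le 1$, $\|\varphi_t(\mathbf{v})\|_{B_j}\le C_j\|\mathbf{v}\|_{B_{j+1}}$ and $\|\overline{\varphi}_t(\mathbf{v})\|_{B_j}\le C_j\|\mathbf{v}\|_{B_{j+1}}$. 2. (Accuracy of the asymptotic approximation) for $0\le t\le 1$, $\|\varphi_t(\mathbf{v})-\overline{\varphi}_t(\mathbf{v})\|_{B_j}\le \epsilon\, C_j\|\mathbf{v}\|_{B_{j+1}}$. 3. $\|\overline{\varphi}_{\Delta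 T}(\mathbf{v}_1)-\overline{\varphi}_{\Delta T}(\mathbf{v}_2)\|_{B_j}\le (1+C_j\Delta T)\|\mathbf{v}_1-\mathbf{v}_2\|_{B_j}$ and $\|\widetilde{\varphi}_{\Delta T}(\mathbf{v}_1)-\widetilde{\varphi}_{\Delta T}(\mathbf{v}_2)\|_{B_j}\le (1+C_j\Delta T)\|\mathbf{v}_1-\mathbf{v}_2\|_{B_j}$. 4. $\|\mathcal{E}_{\varphi,\overline{\varphi}}(\mathbf{v}_1)-\mathcal{E}_{\varphi,\overline{\varphi}}(\mathbf{v}_2)\|_{B_j}\le \epsilon\, C_j\|\mathbf{v}_1-\mathbf{v}_2\|_{B_{j+1}}$ and $\|\mathcal{E}_{\overline{\varphi},\widetilde{\varphi}}(\mathbf{v}_1)-\mathcal{E}_{\overline{\varphi},\widetilde{\varphi}}(\mathbf{v}_2)\|_{B_j}\le C_j\,\Delta T^{p+1}\|\mathbf{v}_1-\mathbf{v}_2\|_{B_{j+1}}$. Given $\mathbf{u}_0$, let $\mathbf{u}(t)=\varphi_t(\mathbf{u}_0)$ and define the parareal iterates by $\mathbf{U}_0^k=\mathbf{u}_0$ for all $k\ge 0$, $\mathbf{U}_n^0=\widetilde{\varphi}_{\Delta T}(\mathbf{U}_{n-1}^0)$ for $n\ge 1$, and, for $k\ge 1$ and $n\ge 1$, $$\mathbf{U}_n^k=\widetilde{\varphi}_{\Delta T}(\mathbf{U}_{n-1}^k)+\left(\varphi_{\Delta T}(\mathbf{U}_{n-1}^{k-1})-\widetilde{\varphi}_{\Delta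 T}(\mathbf{U}_{n-1}^{k-1})\right).$$ Then, assuming that $\mathbf{u}_0=\mathbf{u}(T_0)\in B_{j+k+1}$, the error $\mathbf{u}(T_n)-\mathbf{U}_n^k$ after the $k$th parareal iteration is bounded by $$\left\|\mathbf{u}(T_n)-\mathbf{U}_n^k\right\|_{B_j}\le C_{k,j}\left(\Delta T^p+\epsilon\right)\left(\Delta T^p+\frac{\epsilon}{\Delta T}\right)^k\|\mathbf{u}_0\|_{B_{k+j+1}},$$ where $C_{k,j}$ is a constant that depends only on the constants $C_m$, $m=0,1,\dots,k+j$.
   Context: The full equation is the evolution equation $$\frac{\partial\mathbf{u}}{\partial t}+\frac1\epsilon\mathcal{L}\mathbf{u}=\mathcal{N}(\mathbf{u})+\mathcal{D}\mathbf{u},\qquad \mathbf{u}(0)=\mathbf{u}_0,$$ where $\mathcal{L}$ is a linear operator with purely imaginary eigenvalues, $\mathcal{N}$ is a nonlinearity of polynomial type, $\mathcal{D}$ is an operator encoding some form of dissipation, and $\epsilon>0$ is a small parameter. Its evolution operator is $\varphi_t$, i.e. $\mathbf{u}(t)=\varphi_t(\mathbf{u}_0)$ is the solution; in particular $\mathbf{u}(T_n)=\varphi_{\Delta T}(\mathbf{u}(T_{n-1}))$. The averaged (slow) equation is $$\frac{\partial\overline{\mathbf{u}}}{\partial t}=\overline{\mathcal{N}}(\overline{\mathbf{u}})+\overline{\mathcal{D}}\,\overline{\mathbf{u}},\qquad \overline{\mathbf{u}}(0)=\mathbf{u}_0,$$ with $$\overline{\mathcal{N}}(\mathbf{v})=\lim_{T\to\infty}\frac1T\int_0^T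 e^{s\mathcal{L}}\mathcal{N}(e^{-s\mathcal{L}}\mathbf{v})\,ds,\qquad \overline{\mathcal{D}}\mathbf{v}=\lim_{T\to\infty}\frac1T\int_0^T e^{s\mathcal{L}}\mathcal{D}e^{-s\mathcal{L}}\mathbf{v}\,ds.$$ Let $\psi_t$ be its evolution operator. The asymptotic approximation operator is $\overline{\varphi}_t(\mathbf{u}_0)=e^{-(t/\epsilon)\mathcal{L}}\psi_t(\mathbf{u}_0)$. $\widetilde{\varphi}_{\Delta T}$ denotes the evolution operator associated with solving the averaged equation by an order $p$ time-stepping method (over one step of size $\Delta T$), so that $\widetilde{\varphi}_{\Delta T}(\mathbf{u}_0)$ is a numerical approximation of $\overline{\varphi}_{\Delta T}(\mathbf{u}_0)$. All these operators are in general nonlinear maps. The time interval is $[0,1]$, divided into $N$ subintervals of length $\Delta T=1/N$. $B_j$ typically quantifies the degree of regularity, elements of $B_{j+1}$ being smoother than those of $B_j$. *)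

(* Defs.v *)
From Stdlib Require Import Reals.
From Coquelicot Require Import Coquelicot.
Open Scope R_scope.

(* Scalars are real; a complex Banach space is
   covered through its underlying real Banach space. *)

(* The spaces B_0 >= B_1 >= ... are realised as subspaces of one normed space V,
   in which the differential equations are read; V may be B_0 itself or a larger
   space receiving the values of unbounded operators.  As B_j carries its own
   complete norm, it is a separate Banach space with a linear injection in V.
   No continuity of the inclusions is required. *)
Record banach_scale (V : NormedModule R_AbsRing) := BanachScale {
  level :> nat -> CompleteNormedModule R_AbsRing;
  incl : forall j, level j -> V;
  incl_plus : forall j (x y : level j),
    incl j (plus x y) = plus (incl j x) (incl j y);
  incl_scal : forall j (a : R) (x : level j),
    incl j (scal a x) = scal a (incl j x);
  incl_inj : forall j (x y : level j), incl j x = incl j y -> x = y;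
  incl_nested : forall j (x : level (S j)),
    exists y : level j, incl j y = incl (S j) x
}.
Arguments level {V} _ _.
Arguments incl {V} _ {j} _.

Definition in_level {V : NormedModule R_AbsRing} (B : banach_scale V) (j : nat)
    (v : V) : Prop :=
  exists x : B j, incl B x = v.

(* "v belongs to B_j and its B_j-norm is at most r". *)
Definition norm_le {V : NormedModule R_AbsRing} (B : banach_scale V) (j : nat)
    (v : V) (r : R) : Prop :=
  exists x : B j, incl B x = v /\ norm x <= r.

(* Possibly unbounded operators: [app] is meaningful on [dom] only. *)
Record operator (V : NormedModule R_AbsRing) := Operator {
  dom : V -> Prop;
  app :> V -> V
}.
Arguments dom {V} _ _.
Arguments app {V} _ _.

Definition subspace {V : NormedModule R_AbsRing} (X : V -> Prop) : Prop :=
  X zero /\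
  forall (a : R) (v w : V), X v -> X w -> X (plus (scal a v) w).

Definition linear_operator {V : NormedModule R_AbsRing} (L : operator V) : Prop :=
  subspace (dom L) /\
  forall (a : R) (v w : V), dom L v -> dom L w ->
    L (plus (scal a v) w) = plus (scal a (L v)) (L w).

(* a + i b is an eigenvalue of the complexification of L, with eigenvector
   x + i y.  For a complex-linear L on a complex space, seen as a real space,
   these are the eigenvalues of L and their conjugates. *)
Definition eigenvalue {V : NormedModule R_AbsRing} (L : operator V) (a b : R) :
    Prop :=
  exists x y : V, dom L x /\ dom L y /\ (x <> zero \/ y <> zero) /\
    L x = minus (scal a x) (scal b y) /\
    L y = plus (scal b x) (scal a y).

(* Zero counts as purely imaginary: L may have a kernel (the slow modes). *)
Definition purely_imaginary_eigenvalues {V : NormedModule R_AbsRing}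
    (L : operator V) : Prop :=
  forall a b : R, eigenvalue L a b -> a = 0.

Definition update {V : Type} (x : nat -> V) (i : nat) (v : V) : nat -> V :=
  fun l => if Nat.eqb l i then v else x l.

(* A d-linear map X^d -> V, acting on the first d entries of a sequence. *)
Definition multilinear {V : NormedModule R_AbsRing} (X : V -> Prop) (d : nat)
    (M : (nat -> V) -> V) : Prop :=
  (forall x y : nat -> V, (forall i, (i < d)%nat -> x i = y i) -> M x = M y) /\
  (forall (x : nat -> V) (i : nat) (a : R) (v w : V),
     (i < d)%nat -> (forall l, X (x l)) -> X v -> X w ->
     M (update x i (plus (scal a v) w)) =
     plus (scal a (M (update x i v))) (M (update x i w))).

Definition polynomial_operator {V : NormedModule R_AbsRing} (F : operator V) :
    Prop :=
  subspace (dom F) /\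
  exists (m : nat) (M : nat -> (nat -> V) -> V),
    (forall d, (d <= m)%nat -> multilinear (dom F) d (M d)) /\
    (forall v, dom F v -> F v = sum_n (fun d => M d (fun _ => v)) m).

(* E s is e^{sL}: the strongly continuous group with generator L. *)
Definition exponential_group {V : NormedModule R_AbsRing} (L : operator V)
    (E : R -> V -> V) : Prop :=
  (forall s, is_linear (E s)) /\
  (forall v, E 0 v = v) /\
  (forall s t v, E (s + t) v = E s (E t v)) /\
  (forall v s, continuous (fun r : R => E r v) s) /\
  (forall v w, (dom L v /\ L v = w) <-> is_derive (fun s : R => E s v) 0 w).

(* w is the limit as T -> +oo of (1/T) int_0^T e^{sL} F(e^{-sL} v) ds. *)
Definition is_average {V : NormedModule R_AbsRing} (E : R -> V -> V)
    (F : operator V) (v w : V) : Prop :=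
  (forall s, 0 <= s -> dom F (E (- s) v)) /\
  exists I : R -> V,
    (forall T, 0 < T -> is_RInt (fun s => E s (F (E (- s) v))) 0 T (I T)) /\
    filterlim (fun T => scal (/ T) (I T)) (Rbar_locally p_infty) (locally w).

(* An autonomous equation is given by the relation between the state v and its
   time derivative w.  D is an arbitrary operator: dissipativity, which has no
   single meaning here, is not required of it. *)
Definition full_equation {V : NormedModule R_AbsRing} (eps : R)
    (L N D : operator V) (v w : V) : Prop :=
  dom L v /\ dom N v /\ dom D v /\
  plus w (scal (1 / eps) (L v)) = plus (N v) (D v).

Definition averaged_equation {V : NormedModule R_AbsRing} (E : R -> V -> V)
    (N D : operator V) (v w : V) : Prop :=
  exists Nv Dv : V, is_average E N v Nv /\ is_average E D v Dv /\
    w = plus Nv Dv.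

Definition is_solution {V : NormedModule R_AbsRing} (B : banach_scale V)
    (eqn : V -> V -> Prop) (tau : R) (v : V) (u : R -> V) : Prop :=
  u 0 = v /\
  (forall t, 0 <= t <= tau -> in_level B 0 (u t)) /\
  (forall t, 0 <= t <= tau ->
     filterlim u (within (fun s => 0 <= s <= tau) (locally t)) (locally (u t))) /\
  (forall t, 0 < t < tau -> exists w, eqn (u t) w /\ is_derive u t w).

(* For data in B_1, which the evolution operators are to map into B_0,
   t |-> phi t v is the solution on [0,1], unique on every [0,tau]. *)
Definition evolution_operator {V : NormedModule R_AbsRing} (B : banach_scale V)
    (eqn : V -> V -> Prop) (phi : R -> V -> V) : Prop :=
  forall v, in_level B 1 v ->
    is_solution B eqn 1 v (fun t => phi t v) /\
    (forall tau u, 0 < tau <= 1 -> is_solution B eqn tau v u ->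
       forall t, 0 <= t <= tau -> u t = phi t v).

(* [E s] is e^{sL} and [psi] the evolution operator of the averaged equation. *)
Definition asymptotic_approximation {V : NormedModule R_AbsRing} (eps : R)
    (E : R -> V -> V) (psi : R -> V -> V) (t : R) (v : V) : V :=
  E (- (t / eps)) (psi t v).

(* [step] is one step, of size dT, of a time-stepping method for the averaged
   equation; the result is carried back by e^{-(dT/eps)L}. *)
Definition numerical_approximation {V : NormedModule R_AbsRing} (eps dT : R)
    (E : R -> V -> V) (step : V -> V) (v : V) : V :=
  E (- (dT / eps)) (step v).

(* Order p in the sense of the global error: over the time interval [0,1] the
   iterated method is O(dT^p) accurate, at the cost of one level of the scale.
   The constants C_j are those of the other accuracy estimates.  Summing one-step
   errors instead would bring in the constant C_{j+1} of the next level. *)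
Definition accurate_to_order {V : NormedModule R_AbsRing} (B : banach_scale V)
    (C : nat -> R) (N p : nat) (phibar : R -> V -> V) (phit : V -> V) : Prop :=
  let dT := 1 / INR N in
  forall (j n : nat) (v : B (S j)), (n <= N)%nat ->
    norm_le B j (minus (phibar (INR n * dT) (incl B v))
                       (Nat.iter n phit (incl B v)))
            (C j * dT ^ p * norm v).

(* [parareal fine coarse u0 k n] is U_n^k. *)
Fixpoint parareal {V : NormedModule R_AbsRing} (fine coarse : V -> V) (u0 : V)
    (k : nat) : nat -> V :=
  match k with
  | O => fun n => Nat.iter n coarse u0
  | S k' =>
      fix iterate n :=
        match n with
        | O => u0
        | S n' =>
            plus (coarse (iterate n'))
                 (minus (fine (parareal fine coarse u0 k' n'))
                        (coarse (parareal fine coarse u0 k' n')))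
        end
  end.

(* Main.v *)
(* Since u(T_n) = phi_dT (u(T_(n-1))), the error e_n^k = u(T_n) - U_n^k obeys
     e_n^k = [phit u - phit U^k] + [(phi - phit) u - (phi - phit) U^(k-1)],
   everything taken at T_(n-1).  The first bracket is Lipschitz on B_j with constant
   1 + C_j dT; the second, split through phibar, costs one level of the scale and a
   factor C_j (eps + dT^(p+1)).  Iterating at most 1/dT times turns this factor into
   exp(C_j) C_j (eps/dT + dT^p), gained once per parareal iteration; the case k = 0
   is the accuracy of phibar plus that of the time-stepping method. *)

Require Import Defs.
From Stdlib Require Import Reals Lra Lia.
From Coquelicot Require Import Coquelicot.
Open Scope R_scope.

(** * Differences in an abelian group *)

Lemma minus_plus_plus {G : AbelianGroup} (a b c d : G) :
  minus (plus a b) (plus c d) = plus (minus a c) (minus b d).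
Proof.
unfold minus. rewrite opp_plus, <- !plus_assoc. f_equal.
rewrite !plus_assoc. f_equal. apply plus_comm.
Qed.

Lemma plus_minus_r {G : AbelianGroup} (a b : G) : plus b (minus a b) = a.
Proof.
unfold minus. rewrite (plus_comm b), <- plus_assoc.
etransitivity; [apply f_equal, plus_opp_l|apply plus_zero_r].
Qed.

Lemma minus_minus {G : AbelianGroup} (a b : G) : minus a (minus a b) = b.
Proof.
unfold minus at 1. rewrite opp_minus. apply plus_minus_r.
Qed.

(** * Membership and norm bounds in the scale, and the semigroup law *)

Section Scale.

Context {V : NormedModule R_AbsRing} (B : banach_scale V).

Lemma incl_minus j (x y : B j) : incl B (minus x y) = minus (incl B x) (incl B y).
Proof.
unfold minus. rewrite incl_plus. f_equal.
transitivity (incl B (scal (opp one) y)).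
- f_equal. symmetry. apply (@scal_opp_one R_AbsRing (B j)).
- rewrite incl_scal. apply (@scal_opp_one R_AbsRing V).
Qed.

Lemma in_level_minus j v w :
  in_level B j v -> in_level B j w -> in_level B j (minus v w).
Proof.
intros [x <-] [y <-]. exists (minus x y). apply incl_minus.
Qed.

(** Serves to place a parareal iterate [w] in a level where only the exact solution [v] and the
    error are known to lie. *)
Lemma in_level_minus_l j v w :
  in_level B j v -> in_level B j (minus v w) -> in_level B j w.
Proof.
intros Hv Hvw. rewrite <- (minus_minus v w). now apply in_level_minus.
Qed.

Lemma in_level_le i j v : (i <= j)%nat -> in_level B j v -> in_level B i v.
Proof.
induction 1 as [|j _ IH]; [easy|]. intros [x <-].
destruct (incl_nested _ B j x) as [y Hy]. apply IH. now exists y.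
Qed.

Lemma norm_le_in_level j v r : norm_le B j v r -> in_level B j v.
Proof. intros [x [Hx _]]. now exists x. Qed.

Lemma norm_le_weaken j v r s : norm_le B j v r -> r <= s -> norm_le B j v s.
Proof. intros [x [Hx Hr]] Hs. exists x. split; [easy|lra]. Qed.

Lemma norm_le_plus j v w r s :
  norm_le B j v r -> norm_le B j w s -> norm_le B j (plus v w) (r + s).
Proof.
intros [x [<- Hx]] [y [<- Hy]]. exists (plus x y). split; [apply incl_plus|].
eapply Rle_trans; [apply @norm_triangle|]. now apply Rplus_le_compat.
Qed.

Lemma norm_le_minus_diag j v : in_level B j v -> norm_le B j (minus v v) 0.
Proof.
intros [x <-]. exists (minus x x). split; [apply incl_minus|].
rewrite minus_eq_zero. apply Req_le, @norm_zero.
Qed.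

(** Injectivity of [incl] identifies the witness of the bound on [minus v w] with the difference of
    the preimages of [v] and [w]. The larger constant [c'] lets [Rabs (C j)] replace [C j], whose
    sign is unknown. *)
Lemma norm_le_lipschitz (F : V -> V) i j c c' r v w :
  (forall x y : B i,
     norm_le B j (minus (F (incl B x)) (F (incl B y))) (c * norm (minus x y))) ->
  c <= c' -> 0 <= c' -> in_level B i v -> in_level B i w ->
  norm_le B i (minus v w) r -> norm_le B j (minus (F v) (F w)) (c' * r).
Proof.
intros HF Hc Hc' [x <-] [y <-] [z [Hz Hr]].
rewrite <- incl_minus in Hz. apply incl_inj in Hz. subst z.
apply (norm_le_weaken _ _ _ _ (HF x y)).
apply Rle_trans with (c' * norm (minus x y)).
- apply Rmult_le_compat_r; [apply norm_ge_0|easy].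
- now apply Rmult_le_compat_l.
Qed.

(** The relation [eqn] does not involve time, so a translate of a solution is again a solution. *)
Lemma is_solution_shift eqn s t tau v u :
  0 <= s -> s + t <= tau -> is_solution B eqn tau v u ->
  is_solution B eqn t (u s) (fun r => u (s + r)).
Proof.
intros Hs Ht (_ & Hlev & Hcont & Heqn). split; [|split; [|split]].
- now rewrite Rplus_0_r.
- intros r Hr. apply Hlev. lra.
- intros r Hr P HP. assert (Hsr : 0 <= s + r <= tau) by lra.
  destruct (Hcont _ Hsr P HP) as [d Hd]. exists d.
  intros y Hy Hyt. apply Hd; [|lra].
  change (Rabs ((s + y) - (s + r)) < d). change (Rabs (y - r) < d) in Hy.
  now replace ((s + y) - (s + r)) with (y - r) by ring.
- intros r Hr. destruct (Heqn (s + r)) as [w [Hw Hd]]; [lra|].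
  exists w. split; [easy|].
  rewrite <- (scal_one w). apply (is_derive_comp u (fun r => s + r)); [easy|].
  auto_derive; [easy|reflexivity].
Qed.

(** The solution from [v], restarted at time [s], is known only up to time [1 - s]; uniqueness from
    [phi s v] is therefore invoked on [[0,t]] instead of [[0,1]]. *)
Lemma evolution_semigroup eqn phi s t v :
  evolution_operator B eqn phi -> 0 <= s -> 0 < t -> s + t <= 1 ->
  in_level B 1 v -> in_level B 1 (phi s v) -> phi (s + t) v = phi t (phi s v).
Proof.
intros Hphi Hs Ht Hst Hv Hw.
destruct (Hphi _ Hv) as [Hsol _]. destruct (Hphi _ Hw) as [_ Huniq].
apply (Huniq t (fun r => phi (s + r) v)); [lra| |lra].
now apply (is_solution_shift eqn s t 1 v (fun r => phi r v)).
Qed.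

End Scale.

(** * The error recursion and its constants *)

Lemma parareal_error_split {G : AbelianGroup} (F P Q : G -> G) (u U W : G) :
  minus (F u) (plus (Q U) (minus (F W) (Q W))) =
  plus (minus (Q u) (Q U))
    (plus (minus (minus (F u) (P u)) (minus (F W) (P W)))
          (minus (minus (P u) (Q u)) (minus (P W) (Q W)))).
Proof.
rewrite <- (plus_minus_r (F u) (Q u)) at 1.
rewrite minus_plus_plus. f_equal.
rewrite (minus_trans (P u) (F u)), (minus_trans (P W) (F W)).
apply minus_plus_plus.
Qed.

(** Induction step for [e_(n+1) <= (1 + x) e_n + b], from [1 + x <= exp x] and
    [1 <= exp ((n + 1) x)]. Unlike the quotient form of the geometric sum, the bound [n exp (n x) b]
    also makes sense at [x = 0]. *)
Lemma gronwall_step x b (n : nat) :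
  0 <= x -> 0 <= b ->
  (1 + x) * (INR n * exp (INR n * x) * b) + b <=
  INR (S n) * exp (INR (S n) * x) * b.
Proof.
intros Hx Hb. rewrite S_INR.
replace ((INR n + 1) * x) with (x + INR n * x) by ring. rewrite exp_plus.
pose proof (pos_INR n) as Hn.
pose proof (exp_ineq1_le x) as Hex.
pose proof (exp_ineq1_le (INR n * x)) as Henx.
assert (0 <= INR n * x) by now apply Rmult_le_pos.
assert (H1 : (1 + x) * (INR n * exp (INR n * x)) <=
             exp x * (INR n * exp (INR n * x))).
{ apply Rmult_le_compat_r; [apply Rmult_le_pos; lra|easy]. }
assert (H2 : 1 * 1 <= exp x * exp (INR n * x)) by (apply Rmult_le_compat; lra).
apply (Rmult_le_compat_r b) in H1; [|easy].
apply (Rmult_le_compat_r b) in H2; [|easy]. lra.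
Qed.

(** Each iteration climbs one level, so exactly [C j], ..., [C (k + j)] are read. Absolute values
    keep the product nonnegative. *)
Fixpoint parareal_constant (k j : nat) (C : nat -> R) : R :=
  match k with
  | O => Rabs (C j)
  | S k' => exp (Rabs (C j)) * Rabs (C j) * parareal_constant k' (S j) C
  end.

Lemma parareal_constant_ge0 k j C : 0 <= parareal_constant k j C.
Proof.
revert j. induction k as [|k IH]; intros j; simpl; [apply Rabs_pos|].
apply Rmult_le_pos; [apply Rmult_le_pos|apply IH].
- apply Rlt_le, exp_pos.
- apply Rabs_pos.
Qed.

Lemma parareal_constant_ext k j C C' :
  (forall m, (m <= k + j)%nat -> C m = C' m) ->
  parareal_constant k j C = parareal_constant k j C'.
Proof.
revert j. induction k as [|k IH]; intros j H; simpl.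
- now rewrite H.
- rewrite (H j) by lia. rewrite (IH (S j)); [easy|].
  intros m Hm. apply H. lia.
Qed.

Theorem theorem1 :
  exists K : nat -> nat -> (nat -> R) -> R,
    (forall (k j : nat) (C C' : nat -> R),
       (forall m, (m <= k + j)%nat -> C m = C' m) -> K k j C = K k j C') /\
    forall (V : NormedModule R_AbsRing) (B : banach_scale V)
      (eps : R) (N p : nat)
      (L Nl D : operator V) (E : R -> V -> V)
      (phi psi : R -> V -> V) (step : V -> V) (C : nat -> R),
    let dT := 1 / INR N in
    let phibar := asymptotic_approximation eps E psi in
    let phit := numerical_approximation eps dT E step in
    let err_asym := fun v => minus (phi dT v) (phibar dT v) in
    let err_num := fun v => minus (phibar dT v) (phit v) in
    0 < eps -> (1 <= N)%nat -> (1 <= p)%nat ->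
    linear_operator L -> purely_imaginary_eigenvalues L ->
    polynomial_operator Nl ->
    exponential_group L E ->
    evolution_operator B (full_equation eps L Nl D) phi ->
    evolution_operator B (averaged_equation E Nl D) psi ->
    accurate_to_order B C N p phibar phit ->
    (forall (j : nat) (t : R) (v : B (S j)), 0 <= t <= 1 ->
       norm_le B j (phi t (incl B v)) (C j * norm v) /\
       norm_le B j (phibar t (incl B v)) (C j * norm v)) ->
    (forall (j : nat) (t : R) (v : B (S j)), 0 <= t <= 1 ->
       norm_le B j (minus (phi t (incl B v)) (phibar t (incl B v)))
         (eps * C j * norm v)) ->
    (forall (j : nat) (v1 v2 : B j),
       norm_le B j (minus (phibar dT (incl B v1)) (phibar dT (incl B v2)))
         ((1 + C j * dT) * norm (minus v1 v2)) /\
       norm_le B j (minus (phit (incl B v1)) (phit (incl B v2)))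
         ((1 + C j * dT) * norm (minus v1 v2))) ->
    (forall (j : nat) (v1 v2 : B (S j)),
       norm_le B j (minus (err_asym (incl B v1)) (err_asym (incl B v2)))
         (eps * C j * norm (minus v1 v2)) /\
       norm_le B j (minus (err_num (incl B v1)) (err_num (incl B v2)))
         (C j * dT ^ (p + 1) * norm (minus v1 v2))) ->
    forall (j k n : nat) (u0 : B (k + j + 1)%nat), (n <= N)%nat ->
      norm_le B j
        (minus (phi (INR n * dT) (incl B u0))
               (parareal (phi dT) phit (incl B u0) k n))
        (K k j C * (dT ^ p + eps) * (dT ^ p + eps / dT) ^ k * norm u0).
Proof.
exists parareal_constant. split; [exact parareal_constant_ext|].
intros V B eps N p L Nl D E phi psi step C dT phibar phit err_asym err_num
  Heps HN Hp _ _ _ _ Hphi _ Hord Hbound Hacc Hlip Herr.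
assert (HN1 : 1 <= INR N) by now apply (le_INR 1).
assert (HdT : 0 < dT) by (apply Rdiv_lt_0_compat; lra).
assert (HNdT : INR N * dT = 1) by (unfold dT; field; lra).
assert (HdTp : 0 <= dT ^ p) by (apply pow_le; lra).
assert (Htime : forall n, (n <= N)%nat -> 0 <= INR n * dT <= 1).
{ intros n Hn. apply le_INR in Hn. pose proof (pos_INR n). split.
  - apply Rmult_le_pos; lra.
  - rewrite <- HNdT. apply Rmult_le_compat_r; lra. }
(* The level m of u0 is a variable, so that the step from (k, S j) to (S k, j),
   which have the same m, needs no cast. *)
assert (Hmain : forall k j m (u0 : B m) n, m = S (k + j) -> (n <= N)%nat ->
  norm_le B j
    (minus (phi (INR n * dT) (incl B u0))
           (parareal (phi dT) phit (incl B u0) k n))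
    (parareal_constant k j C * (dT ^ p + eps) * (dT ^ p + eps / dT) ^ k * norm u0)).
2: { intros j k n u0 Hn. apply Hmain; [lia|easy]. }
induction k as [|k IHk]; intros j m u0 n Hm Hn.
- simpl in Hm. subst m.
  pose proof (RRle_abs (C j)) as HCj.
  (* Both accuracy estimates apply directly at time [T_n], so no one-step errors are summed. *)
  rewrite (minus_trans (phibar (INR n * dT) (incl B u0))).
  eapply norm_le_weaken.
  { apply norm_le_plus; [apply Hacc, Htime, Hn|apply Hord, Hn]. }
  fold dT. simpl.
  assert (H0 : 0 <= (dT ^ p + eps) * norm u0).
  { apply Rmult_le_pos; [lra|apply norm_ge_0]. }
  apply (Rmult_le_compat_r _ _ _ H0) in HCj. lra.
- set (c := Rabs (C j)).
  assert (Hc : C j <= c) by apply RRle_abs.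
  assert (Hc0 : 0 <= c) by apply Rabs_pos.
  assert (Hu0 : forall i, (i <= m)%nat -> in_level B i (incl B u0)).
  { intros i Hi. apply (in_level_le B i m); [easy|]. now exists u0. }
  (* Only membership is drawn from the uniform bound; the inequality is strict because that bound
     costs one level. *)
  assert (Hu : forall i t, (i < m)%nat -> 0 <= t <= 1 ->
            in_level B i (phi t (incl B u0))).
  { intros i t Hi Ht. destruct (Hu0 (S i) Hi) as [x Hx]. rewrite <- Hx.
    apply (norm_le_in_level B _ _ _ (proj1 (Hbound i t x Ht))). }
  (* The error bound of iteration [k] one level up, uniform in the time index. *)
  set (r := parareal_constant k (S j) C * (dT ^ p + eps) *
            (dT ^ p + eps / dT) ^ k * norm u0).
  assert (Hq : 0 <= dT ^ p + eps / dT).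
  { pose proof (Rdiv_lt_0_compat _ _ Heps HdT). lra. }
  assert (Hr : 0 <= r).
  { unfold r. apply Rmult_le_pos; [|apply norm_ge_0].
    apply Rmult_le_pos; [|now apply pow_le].
    apply Rmult_le_pos; [apply parareal_constant_ge0|lra]. }
  assert (HdTp1 : 0 <= dT ^ (p + 1)) by (apply pow_le; lra).
  (* Source term of the recursion: the Lipschitz bounds of [err_asym] and [err_num] applied to an
     error of size [r]. *)
  set (b := eps * c * r + c * dT ^ (p + 1) * r).
  assert (Hb1 : 0 <= eps * c) by (apply Rmult_le_pos; lra).
  assert (Hb2 : 0 <= c * dT ^ (p + 1)) by now apply Rmult_le_pos.
  assert (Hb : 0 <= b).
  { unfold b. apply Rplus_le_le_0_compat; now apply Rmult_le_pos. }
  assert (Hx : 0 <= c * dT) by (apply Rmult_le_pos; lra).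
  assert (Hn_bound : forall i, (i <= N)%nat ->
    norm_le B j
      (minus (phi (INR i * dT) (incl B u0))
             (parareal (phi dT) phit (incl B u0) (S k) i))
      (INR i * exp (INR i * (c * dT)) * b)).
  { induction i as [|i IHi]; intros Hi.
    - simpl. rewrite !Rmult_0_l.
      destruct (Hphi (incl B u0)) as [[H0 _] _]; [apply Hu0; lia|].
      rewrite H0. apply norm_le_minus_diag, Hu0. lia.
    - assert (Hi' : (i <= N)%nat) by lia. specialize (IHi Hi').
      pose proof (Htime i Hi') as Hti. pose proof (Htime (S i) Hi) as HtSi.
      assert (Hsemi : phi (INR (S i) * dT) (incl B u0) =
                      phi dT (phi (INR i * dT) (incl B u0))).
      (* Restarting at [T_i] requires the solution there to lie in level 1; one level is lost in
         reaching it, and [m = k + j + 2] leaves room. *)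
      { rewrite S_INR in HtSi |- *.
        replace ((INR i + 1) * dT) with (INR i * dT + dT) in HtSi |- * by ring.
        apply (evolution_semigroup B _ _ _ _ _ Hphi); try lra.
        - apply Hu0. lia.
        - apply Hu; [lia|easy]. }
      rewrite Hsemi. clear Hsemi.
      pose proof (IHk (S j) m u0 i ltac:(lia) Hi') as IHW. fold r in IHW.
      change (parareal (phi dT) phit (incl B u0) (S k) (S i)) with
        (plus (phit (parareal (phi dT) phit (incl B u0) (S k) i))
          (minus (phi dT (parareal (phi dT) phit (incl B u0) k i))
                 (phit (parareal (phi dT) phit (incl B u0) k i)))).
      set (u := phi (INR i * dT) (incl B u0)) in *.
      set (U := parareal (phi dT) phit (incl B u0) (S k) i) in *.
      set (W := parareal (phi dT) phit (incl B u0) k i) in *.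
      assert (Huj : in_level B j u) by (apply Hu; [lia|easy]).
      assert (HuSj : in_level B (S j) u) by (apply Hu; [lia|easy]).
      assert (HU : in_level B j U) by (eapply in_level_minus_l, norm_le_in_level, IHi; easy).
      assert (HW : in_level B (S j) W) by (eapply in_level_minus_l, norm_le_in_level, IHW; easy).
      rewrite (parareal_error_split (phi dT) (phibar dT) phit).
      eapply norm_le_weaken; [|apply gronwall_step; [exact Hx|exact Hb]].
      apply norm_le_plus; [|apply norm_le_plus].
      + apply (norm_le_lipschitz B phit j j (1 + C j * dT)); try easy.
        * intros x y. apply Hlip.
        * apply Rplus_le_compat_l, Rmult_le_compat_r; lra.
        * lra.
      + apply (norm_le_lipschitz B err_asym (S j) j (eps * C j)); try easy.
        * intros x y. apply Herr.
        * apply Rmult_le_compat_l; lra.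
      + apply (norm_le_lipschitz B err_num (S j) j (C j * dT ^ (p + 1))); try easy.
        * intros x y. apply Herr.
        * now apply Rmult_le_compat_r. }
  apply (norm_le_weaken _ _ _ _ _ (Hn_bound n Hn)).
  (* The count [N = 1 / dT] turns [eps + dT ^ (p + 1)] in [b] into [eps / dT + dT ^ p], the factor
     gained by this iteration; [exp c] bounds the growth since [n dT <= 1]. *)
  replace (parareal_constant (S k) j C * _ * _ * _) with (INR N * exp c * b).
  + apply Rmult_le_compat_r; [easy|].
    apply Rmult_le_compat.
    * apply pos_INR.
    * apply Rlt_le, exp_pos.
    * now apply le_INR.
    * destruct (Htime n Hn) as [_ Ht].
      assert (Hle : INR n * (c * dT) <= c).
      { replace (INR n * (c * dT)) with (c * (INR n * dT)) by ring.
        rewrite <- (Rmult_1_r c) at 2. now apply Rmult_le_compat_l. }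
      destruct Hle as [Hlt|Heq]; [now apply Rlt_le, exp_increasing|].
      rewrite Heq. apply Rle_refl.
  + unfold b, r. rewrite pow_add, pow_1. simpl. fold c.
    replace (INR N) with (/ dT) by (unfold dT; field; lra).
    field. lra.
Qed.
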